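(* Let $p$ be a prime, let $d \geq 1$ be an integer and let $A = \mathrm{Mat}_{d \times d}(\mathbf F_p)$. Given matrices $a, b, c \in A$, let $\mathcal M \colon \mathbf Z^2 \to A$ be the tiling recursively defined by the following conditions: $\mathcal M(0, 0) = 1$ (the identity matrix), $\mathcal M(m, n) = 0$ if $(m, n) \not \in \mathbf N^2$, and $$\mathcal M(m, n) = a \mathcal M(m-1, n) + b\mathcal M(m, n-1) + c \mathcal M(m-1, n-1)$$ if $(m, n) \in \mathbf N^2 \setminus \{(0, 0)\}$. Then there is a $2$-dimensional tiling $\overline{\mathcal T}\colon\mathbf Z^2\to A$ with color set $A$, invariant under a linear substitution of length $p$, and a linear map $\tau \colon A \to A$ such that $\mathcal M = \tau \circ \overline{\mathcal T}$.
   Context: $\mathbf F_p=\mathbf Z/p\mathbf Z$ and $\mathbf N$ is the set of non-negative integers. For sets $A,E$, $A^E$ denotes the set of all maps $E\to A$; if $A$ is an $\mathbf F_p$-vector space, so is $A^E$ (pointwise operations). ''Linear'' means $\mathbf F_p$-linear. A $2$-dimensional tiling with color set $A$ is a map $\mathcal T\colon\mathbf Z^2\to A$. A $2$-dimensional substitution of length $\ell\ge 1$ on $A$ is a map $\mathcal S\colon A\to A^{\mathcal I^2}$, $a\mapsto\mathcal S_a$, with $\mathcal I=\{0,\dots,\ell-1\}$. A tiling $\mathcal T\in A^{\mathbf Z^2}$ is invariant under $\mathcal S$ if $\mathcal T(\ell\boldsymbol{\alpha}+\boldsymbol{\beta})=\mathcal S_{\mathcal T(\boldsymbol{\alpha})}(\boldsymbol{\beta})$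 for all $\boldsymbol{\alpha}\in\mathbf Z^2$, $\boldsymbol{\beta}\in\mathcal I^2$. The substitution is linear if the map $\mathcal S\colon A\to A^{\mathcal I^2}$ is linear. *)

(* Defs.v *)
From HB Require Import structures.
From mathcomp Require Import all_boot all_order all_algebra.

Set Implicit Arguments.
Unset Strict Implicit.
Unset Printing Implicit Defensive.

Import Order.TTheory GRing.Theory Num.Theory.
Local Open Scope ring_scope.

Definition tiling (A : Type) : Type := int * int -> A.

Definition substitution (l : nat) (A : Type) : Type :=
  A -> {ffun 'I_l * 'I_l -> A}.

Definition invariant_under (l : nat) (A : Type)
    (S : substitution l A) (T : tiling A) : Prop :=
  forall (m n : int) (i j : 'I_l),
    T (l%:Z * m + (i : nat)%:Z, l%:Z * n + (j : nat)%:Z) = S (T (m, n)) (i, j).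

(* These conditions determine M uniquely, by induction on m + n. *)
Definition recursive_tiling (R : pzRingType) (d : nat) (a b c : 'M[R]_d)
    (M : tiling 'M[R]_d) : Prop :=
  [/\ M (0, 0) = 1%:M,
      forall m n : int, ~~ ((0 <= m) && (0 <= n)) -> M (m, n) = 0
    & forall m n : int, 0 <= m -> 0 <= n -> (m, n) != (0, 0) ->
        M (m, n) = a *m M (m - 1, n) + b *m M (m, n - 1)
                   + c *m M (m - 1, n - 1)].

(* Main.v *)
(* With P = 1 - a x - b y - c x y and D = det P, the generating function of M is
   P^-1 = adj P / D.  The coefficients of adj P and D in x and y have degree at
   most d - 1 and d in each variable, so the entries of M lie in the
   d^2-dimensional space of the series Q / D with deg_x Q, deg_y Q < d.  Writing
   Q / D = Q D^(p-1) / D^p and D^p = D(x^p, y^p), the series with index in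
   (i, j) + p Z^2 is Q' / D where Q' is made of every p-th coefficient of
   Q D^(p-1), which has degree < d p in each variable; so that space is stable
   under decimation.  The tiling T lists the coordinates (x^k y^l) / D, and the
   substitution is the transpose of decimation.  Power series are replaced by
   the polynomials D^(p^N-1), which agree with 1/D in degrees < p^N because
   D^(p^N) = D(x^(p^N), y^(p^N)) and D(0, 0) = 1. *)

Require Import Defs.
From HB Require Import structures.
From mathcomp Require Import all_boot all_order all_algebra.
From mathcomp Require Import finfield zify ring.

Import Order.TTheory GRing.Theory Num.Theory.
Local Open Scope ring_scope.

Set Implicit Arguments.
Unset Strict Implicit.
Unset Printing Implicit Defensive.

(** * Coefficients at integer indices and decimation in one variable *)

(** The zero value at negative indices makes multiplication by ['X^k] an index shift without side
    conditions. *)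
Definition zcoef (R : nzRingType) (z : int) (f : {poly R}) : R :=
  if z is Posz n then f`_n else 0.

Lemma zcoef_is_additive (R : nzRingType) (z : int) :
  zmod_morphism (@zcoef R z).
Proof. by move=> f g; case: z => n /=; rewrite ?coefB ?subr0. Qed.

HB.instance Definition _ (R : nzRingType) (z : int) :=
  GRing.isZmodMorphism.Build {poly R} R (@zcoef R z) (zcoef_is_additive z).

Lemma zcoefZ (R : nzRingType) (z : int) (x : R) (f : {poly R}) :
  zcoef z (x *: f) = x * zcoef z f.
Proof. by case: z => n /=; rewrite ?coefZ ?mulr0. Qed.

Lemma zcoefXnM (R : nzRingType) (z : int) (k : nat) (f : {poly R}) :
  zcoef z ('X^k * f) = zcoef (z - k%:Z) f.
Proof.
case: z => n /=.
  rewrite coefXnM; case: ltnP => [lt_nk | le_kn].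
    (* [Negz m] is -(m + 1), hence the predecessor in the witness. *)
    by have [m ->] : exists m, n%:Z - k%:Z = Negz m; [exists (k - n).-1; lia|].
  by rewrite subzn.
by have [m ->] : exists m, Negz n - k%:Z = Negz m; [exists (n + k)%N; lia|].
Qed.

Lemma zcoefM (R : nzRingType) (K : nat) (z : int) (f g : {poly R}) :
  (size f <= K)%N ->
  zcoef z (f * g) = \sum_(k < K) f`_k * zcoef (z - k%:Z) g.
Proof.
move=> szf.
have {1}-> : f = \poly_(k < K) f`_k.
  apply/polyP => k; rewrite coef_poly; case: ltnP => // /(leq_trans szf).
  exact: nth_default.
rewrite poly_def mulr_suml raddf_sum; apply: eq_bigr => k _ /=.
by rewrite -scalerAl zcoefZ zcoefXnM.
Qed.

Lemma zcoef_comp_Xn (R : comNzRingType) (p : nat) (z : int) (f : {poly R}) :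
  (0 < p)%N -> zcoef (p%:Z * z) (f \Po 'X^p) = zcoef z f.
Proof.
move=> p_gt0; case: z => n.
  by rewrite -PoszM /= coef_comp_poly_Xn // dvdn_mulr // mulKn.
by have [m ->] : exists m, p%:Z * Negz n = Negz m; [exists (p * n.+1).-1; nia|].
Qed.

Lemma zcoef_comp_Xn_ndvd (R : comNzRingType) (p : nat) (z : int)
    (f : {poly R}) :
  (0 < p)%N -> ~~ (p%:Z %| z)%Z -> zcoef z (f \Po 'X^p) = 0.
Proof.
move=> p_gt0; case: z => n //= ndvd.
by rewrite coef_comp_poly_Xn //; case: ifP => // dvd; case/negP: ndvd.
Qed.

Lemma sum_nat_arith_prog (V : nmodType) (p d i : nat) (F : nat -> V) :
  (i < p)%N -> (forall r, (r %% p)%N != i -> F r = 0) ->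
  \sum_(0 <= r < d * p) F r = \sum_(0 <= k < d) F (p * k + i)%N.
Proof.
move=> lt_ip F0; elim: d => [|d IHd]; first by rewrite mul0n !big_geq.
rewrite big_nat_recr //= -IHd [LHS](@big_cat_nat _ _ _ (d * p)%N) //=;
  last by rewrite leq_mul2r leqnSn orbT.
congr (_ + _); rewrite mulSn -{1}[(d * p)%N]add0n big_addn addnK big_mkord.
rewrite (bigD1 (Ordinal lt_ip)) //= big1 ?addr0 => [|r ne_ri].
  by rewrite mulnC addnC.
by apply: F0; rewrite addnC modnMDl modn_small.
Qed.

(** All exponents in [g \Po 'X^p] are multiples of [p], so only coefficients of [f] at indices
    congruent to [i] contribute. *)
Lemma zcoef_decimation (R : comNzRingType) (p d : nat) (z : int) (i : 'I_p)
    (f g : {poly R}) :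
  (size f <= d * p)%N ->
  zcoef (p%:Z * z + i%:Z) (f * (g \Po 'X^p)) =
  \sum_(k < d) f`_(p * k + i) * zcoef (z - k%:Z) g.
Proof.
move=> szf; have p_gt0 : (0 < p)%N by case: i => i /=; case: (p).
rewrite (zcoefM _ _ szf).
rewrite -(big_mkord xpredT (fun r => f`_r *
  zcoef (p%:Z * z + i%:Z - r%:Z) (g \Po 'X^p))).
rewrite -(big_mkord xpredT (fun k => f`_(p * k + i) * zcoef (z - k%:Z) g)).
rewrite (@sum_nat_arith_prog _ p d i) //.
  apply: eq_bigr => k _; congr (_ * _); rewrite -[RHS](zcoef_comp_Xn _ _ p_gt0).
  congr zcoef; rewrite PoszD PoszM; ring.
move=> r ne_ri; rewrite zcoef_comp_Xn_ndvd ?mulr0 //.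
apply: contra ne_ri => /dvdzP [q] e.
have e' : (r%:Z = (z - q) * p%:Z + i%:Z) by rewrite mulrBl -e; ring.
have : (r%:Z = i%:Z %[mod p%:Z])%Z by rewrite e' modzMDl.
by rewrite !modz_nat => -[->]; rewrite modn_small.
Qed.

(** * Frobenius on polynomials *)

(** Frobenius is a ring morphism, so it acts term by term. The coefficients keep their powers
    because [R] may itself be a polynomial ring. *)
Lemma poly_expp (R : comNzRingType) (p : nat) (f : {poly R}) :
  p \in [pchar R] -> f ^+ p = (\poly_(k < size f) (f`_k ^+ p)) \Po 'X^p.
Proof.
move=> chR; have chRX : p \in [pchar {poly R}] by rewrite pchar_poly.
rewrite -[LHS](pFrobenius_autE chRX) -{1}[f]coefK poly_def rmorph_sum /=.
rewrite poly_def rmorph_sum /=; apply: eq_bigr => k _.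
by rewrite pFrobenius_autE exprZn comp_polyZ comp_Xn_poly -!exprM mulnC.
Qed.

Lemma zcoef_expp (R : comNzRingType) (p : nat) (z : int) (f : {poly R}) :
  (0 < p)%N -> zcoef z (\poly_(k < size f) (f`_k ^+ p)) = zcoef z f ^+ p.
Proof.
move=> p_gt0; case: z => n /=; last by rewrite expr0n eqn0Ngt p_gt0.
rewrite coef_poly; case: ltnP => // le_fn.
by rewrite nth_default // expr0n eqn0Ngt p_gt0.
Qed.

Lemma Fp_poly_expp (p : nat) (f : {poly 'F_p}) :
  prime p -> f ^+ p = f \Po 'X^p.
Proof.
move=> pr_p; rewrite (poly_expp _ (pchar_Fp pr_p)) -[in RHS](coefK f).
congr (_ \Po _); apply/polyP => k; rewrite !coef_poly; case: ifP => // _.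
by have := expf_card f`_k; rewrite card_Fp.
Qed.

(** Write f = g X + f_0. With q = p^N, iterated Frobenius gives g^q X^q + f_0^q, whose first term
    starts in degree q. *)
Lemma coef_exp_pchar (R : comNzRingType) (p N n : nat) (f : {poly R}) :
  p \in [pchar R] -> (n < p ^ N)%N ->
  (f ^+ (p ^ N))`_n = if n == 0%N then f`_0 ^+ (p ^ N) else 0.
Proof.
move=> chR lt_nq; have chRX : p \in [pchar {poly R}] by rewrite pchar_poly.
have [g Df] : exists g, f = g * 'X + (f`_0)%:P.
  elim/poly_ind: f => [|g x _]; first by exists 0; rewrite mul0r coef0 addr0.
  by exists g; rewrite coefD coefMX coefC add0r.
rewrite {1}Df exprDn_pchar ?pnatX ?pnatE ?(pcharf_prime chR) ?chRX //.
by rewrite exprMn coefD coefMXn lt_nq add0r -polyC_exp coefC.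
Qed.

(** * Bivariate polynomials: degree bounds and coefficients *)

(* Bivariate polynomials are elements of [{poly {poly R}}]: x is ['X%:P], y is
   ['X], and the coefficient of x^m y^n is [f`_n`_m]. *)
Definition zcoef2 (R : nzRingType) (u v : int) (f : {poly {poly R}}) : R :=
  zcoef u (zcoef v f).

Definition bideg_le (R : nzRingType) (K : nat) (f : {poly {poly R}}) : Prop :=
  forall m n, (K < m)%N || (K < n)%N -> f`_n`_m = 0.

Lemma bideg_le_size (R : nzRingType) (K : nat) (f : {poly {poly R}}) :
  bideg_le K f -> (size f <= K.+1)%N.
Proof.
move=> fK; apply/leq_sizeP => n lt_Kn; apply/polyP => m.
by rewrite coef0 fK // lt_Kn orbT.
Qed.

Lemma bideg_le_size_coef (R : nzRingType) (K n : nat) (f : {poly {poly R}}) :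
  bideg_le K f -> (size (f`_n)%R <= K.+1)%N.
Proof. by move=> fK; apply/leq_sizeP => m lt_Km; rewrite fK // lt_Km. Qed.

Lemma bideg_leW (R : nzRingType) (K L : nat) (f : {poly {poly R}}) :
  (K <= L)%N -> bideg_le K f -> bideg_le L f.
Proof. by move=> le_KL fK m n lt_L; apply: fK; lia. Qed.

Lemma bideg_leD (R : nzRingType) (K : nat) (f g : {poly {poly R}}) :
  bideg_le K f -> bideg_le K g -> bideg_le K (f + g).
Proof. by move=> fK gK m n lt_K; rewrite !coefD fK // gK // addr0. Qed.

Lemma bideg_leN (R : nzRingType) (K : nat) (f : {poly {poly R}}) :
  bideg_le K f -> bideg_le K (- f).
Proof. by move=> fK m n lt_K; rewrite !coefN fK // oppr0. Qed.

Lemma bideg_leM (R : nzRingType) (K L : nat) (f g : {poly {poly R}}) :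
  bideg_le K f -> bideg_le L g -> bideg_le (K + L) (f * g).
Proof.
move=> fK gL m n lt_KL; rewrite coefM coef_sum big1 // => -[s /= lt_sn] _.
rewrite coefM big1 // => -[r /= lt_rm] _.
have [lt_K | ge_K] := boolP ((K < r) || (K < s))%N.
  by rewrite fK // mul0r.
by rewrite gL ?mulr0 //; lia.
Qed.

Lemma bideg_le_const (R : nzRingType) (x : R) : bideg_le 0 x%:P%:P.
Proof.
move=> m n; rewrite coefC; case: eqP => [->|_]; last by rewrite coef0.
by rewrite orbF coefC; case: m.
Qed.

Lemma bideg_le1 (R : nzRingType) : bideg_le 0 (1 : {poly {poly R}}).
Proof. by rewrite -polyC1 -[1%R]polyC1; apply: bideg_le_const. Qed.

Lemma bideg_le_exp (R : nzRingType) (K e : nat) (f : {poly {poly R}}) :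
  bideg_le K f -> bideg_le (e * K) (f ^+ e).
Proof.
move=> fK; elim: e => [|e IHe]; first exact: bideg_le1.
by rewrite exprS mulSn; apply: bideg_leM.
Qed.

Lemma bideg_le_sign (R : nzRingType) (e : nat) :
  bideg_le 0 ((-1) ^+ e : {poly {poly R}}).
Proof.
by have := @bideg_le_exp R 0 e _ (bideg_leN (bideg_le1 R)); rewrite muln0.
Qed.

Lemma bideg_le_det (R : comNzRingType) (K d : nat)
    (A : 'M[{poly {poly R}}]_d) :
  (forall i j, bideg_le K (A i j)) -> bideg_le (d * K) (\det A).
Proof.
move=> AK; rewrite /determinant; apply: (big_ind (bideg_le (d * K))).
- by move=> m n _; rewrite !coef0.
- exact: bideg_leD.
move=> s _; rewrite -[(d * K)%N]add0n; apply: bideg_leM.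
  exact: bideg_le_sign.
(* As a sum of [K] over the indices, the bound [d * K] grows in step with the product of entries. *)
rewrite -[d in (d * K)%N]card_ord -sum1_card big_distrl /=.
apply: (big_ind2 (fun f k => bideg_le k f)) => [|f k g l|i _].
- exact: bideg_le1.
- exact: bideg_leM.
by rewrite mul1n.
Qed.

Lemma bideg_le_adj (R : comNzRingType) (K d : nat)
    (A : 'M[{poly {poly R}}]_d) (i j : 'I_d) :
  (forall i j, bideg_le K (A i j)) -> bideg_le (d.-1 * K) ((\adj A) i j).
Proof.
move=> AK; rewrite mxE -[(d.-1 * K)%N]add0n; apply: bideg_leM.
  exact: bideg_le_sign.
by apply: bideg_le_det => i' j'; rewrite !mxE.
Qed.

Lemma zcoef2M (R : nzRingType) (K : nat) (u v : int)
    (f g : {poly {poly R}}) :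
  bideg_le K f ->
  zcoef2 u v (f * g) = \sum_(l < K.+1) \sum_(k < K.+1)
    f`_l`_k * zcoef2 (u - k%:Z) (v - l%:Z) g.
Proof.
move=> fK; rewrite /zcoef2 (zcoefM _ _ (bideg_le_size fK)) raddf_sum /=.
by apply: eq_bigr => l _; rewrite (zcoefM _ _ (bideg_le_size_coef l fK)).
Qed.

Lemma zcoef2XM (R : nzRingType) (k l : nat) (u v : int)
    (f : {poly {poly R}}) :
  zcoef2 u v ('X^k%:P * 'X^l * f) = zcoef2 (u - k%:Z) (v - l%:Z) f.
Proof. by rewrite /zcoef2 -mulrA mul_polyC zcoefZ !zcoefXnM. Qed.

(** Decimation in y leaves [p]-th powers of the y-coefficients of [g]. These are polynomials over
    ['F_p], so the powers are substitutions of x^p and decimation in x applies. *)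
Lemma zcoef2_decimation (p d : nat) (u v : int) (i j : 'I_p)
    (f g : {poly {poly 'F_p}}) :
  prime p -> (0 < d)%N -> bideg_le (d * p).-1 f ->
  zcoef2 (p%:Z * u + i%:Z) (p%:Z * v + j%:Z) (f * g ^+ p) =
  \sum_(l < d) \sum_(k < d)
    f`_(p * l + j)`_(p * k + i) * zcoef2 (u - k%:Z) (v - l%:Z) g.
Proof.
move=> pr_p d_gt0 fdp; have p_gt0 := prime_gt0 pr_p.
have chX : p \in [pchar {poly 'F_p}] by rewrite pchar_poly pchar_Fp.
have dpK : (d * p).-1.+1 = (d * p)%N by rewrite prednK // muln_gt0 d_gt0.
rewrite /zcoef2 (poly_expp _ chX) (@zcoef_decimation _ p d); last first.
  by rewrite -dpK bideg_le_size.
rewrite raddf_sum /=; apply: eq_bigr => l _.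
rewrite zcoef_expp // Fp_poly_expp // (@zcoef_decimation _ p d) //.
by rewrite -dpK bideg_le_size_coef.
Qed.

(** [f] is 1 modulo the ideal (x^q, y^q), which coefficients at indices below [q] cannot detect. *)
Lemma zcoef2_mul_trunc (R : nzRingType) (q : nat) (u v : int)
    (f g : {poly {poly R}}) :
  (forall m n, (m < q)%N -> (n < q)%N ->
     f`_n`_m = ((m == 0%N) && (n == 0%N))%:R) ->
  u < q%:Z -> v < q%:Z -> zcoef2 u v (f * g) = zcoef2 u v g.
Proof.
move=> f1; rewrite /zcoef2; case: v => n; last by rewrite !raddf0.
case: u => m //= ltm ltn; rewrite coefM coef_sum big_ord_recl /= subn0.
rewrite big1 ?addr0 => [|s _]; rewrite coefM.
  rewrite big_ord_recl f1 //= ?mul1r ?subn0 ?big1 ?addr0 //; try lia.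
  by move=> r _; rewrite f1 ?mul0r //= /bump /=; have := ltn_ord r; lia.
rewrite big1 // => r _; rewrite f1 /= /bump /= ?andbF ?mul0r //.
  by have := ltn_ord r; lia.
by have := ltn_ord s; lia.
Qed.

Lemma exp_pchar_trunc (R : comNzRingType) (p N m n : nat)
    (f : {poly {poly R}}) :
  p \in [pchar R] -> f`_0`_0 = 1 -> (m < p ^ N)%N -> (n < p ^ N)%N ->
  (f ^+ (p ^ N))`_n`_m = ((m == 0%N) && (n == 0%N))%:R.
Proof.
move=> chR f1 ltm ltn; have chRX : p \in [pchar {poly R}] by rewrite pchar_poly.
rewrite (coef_exp_pchar _ chRX ltn); case: (n == 0%N); last first.
  by rewrite andbF coef0.
by rewrite (coef_exp_pchar _ chR ltm) f1 expr1n; case: (m == 0%N).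
Qed.

(** * Truncated reciprocals *)

Definition recip_trunc (p : nat) (D : {poly {poly 'F_p}}) (N : nat) :
  {poly {poly 'F_p}} := D ^+ (p ^ N).-1.

(* The coefficient of x^u y^v in 1/D when D(0, 0) = 1: the exponent |u| + |v| is
   only one choice of an [N] with u, v < p^N. *)
Definition recip_coef (p : nat) (D : {poly {poly 'F_p}}) (u v : int) : 'F_p :=
  zcoef2 u v (recip_trunc D (`|u| + `|v|)).

(** The truncated form of 1/D = D^(p-1) / D^p, from p^(N+1) - 1 = (p - 1) + p (p^N - 1). *)
Lemma recip_truncS (p N : nat) (D : {poly {poly 'F_p}}) :
  (0 < p)%N -> recip_trunc D N.+1 = D ^+ p.-1 * recip_trunc D N ^+ p.
Proof.
move=> p_gt0; rewrite /recip_trunc -exprM -exprD; congr (_ ^+ _).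
have := expn_gt0 p N; rewrite p_gt0 expnS /=; nia.
Qed.

(** The truncations differ by a factor that is the p^N-th power of a polynomial with constant term
    1, hence is 1 modulo x^(p^N) and y^(p^N). *)
Lemma zcoef2_recip_truncD (p N k : nat) (D : {poly {poly 'F_p}}) (u v : int) :
  prime p -> D`_0`_0 = 1 -> u < (p ^ N)%:Z -> v < (p ^ N)%:Z ->
  zcoef2 u v (recip_trunc D (N + k)) = zcoef2 u v (recip_trunc D N).
Proof.
move=> pr_p D1 ltu ltv; have p_gt0 := prime_gt0 pr_p.
have -> : recip_trunc D (N + k) =
    (D ^+ (p ^ k).-1) ^+ (p ^ N) * recip_trunc D N.
  rewrite /recip_trunc -exprM -exprD; congr (_ ^+ _).
  have := expn_gt0 p N; have := expn_gt0 p k; rewrite p_gt0 expnD /=; nia.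
rewrite (@zcoef2_mul_trunc _ (p ^ N)) // => m n ltm ltn.
apply: exp_pchar_trunc => //; first exact: pchar_Fp.
elim: (_.-1) => [|e IHe]; first by rewrite !coef1.
by rewrite exprS coef0M coef0M D1 IHe mulr1.
Qed.

Lemma recip_coefE (p N : nat) (D : {poly {poly 'F_p}}) (u v : int) :
  prime p -> D`_0`_0 = 1 -> u < (p ^ N)%:Z -> v < (p ^ N)%:Z ->
  recip_coef D u v = zcoef2 u v (recip_trunc D N).
Proof.
(* Both exponents are compared with their sum. *)
move=> pr_p D1 ltu ltv; rewrite /recip_coef -(zcoef2_recip_truncD N) //.
- by rewrite addnC zcoef2_recip_truncD.
- by have := ltn_expl (`|u| + `|v|) (prime_gt1 pr_p); lia.
by have := ltn_expl (`|u| + `|v|) (prime_gt1 pr_p); lia.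
Qed.

Lemma bideg_le_monomial (R : nzRingType) (K k l : nat) :
  (k <= K)%N -> (l <= K)%N -> bideg_le K ('X^k%:P * 'X^l : {poly {poly R}}).
Proof.
move=> lekK lelK m n; rewrite coefCM !coefXn => lt_K.
have [en | _] := eqVneq n l; last by rewrite mulr0 coef0.
by rewrite mulr1 coefXn; case: eqP => // em; lia.
Qed.

Lemma exists_exp_gt (p : nat) (u v : int) :
  prime p -> exists N, u < (p ^ N)%:Z /\ v < (p ^ N)%:Z.
Proof.
move=> pr_p; exists (`|u| + `|v|)%N.
by have := ltn_expl (`|u| + `|v|) (prime_gt1 pr_p); lia.
Qed.

(** * The pencil, its adjugate and the recursion *)

Definition pencil (R : nzRingType) (d : nat) (a b c : 'M[R]_d) :
    'M[{poly {poly R}}]_d :=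
  let lift := map_mx (fun x : R => x%:P%:P) in
  1%:M - 'X%:P *: lift a - 'X *: lift b - ('X%:P * 'X) *: lift c.

Lemma bideg_le_pencil (R : nzRingType) (d : nat) (a b c : 'M[R]_d) i j :
  bideg_le 1 (pencil a b c i j).
Proof.
have bX := @bideg_le_monomial R 1 1 0 isT isT.
have bY := @bideg_le_monomial R 1 0 1 isT isT.
have bXY := @bideg_le_monomial R 1 1 1 isT isT.
rewrite expr0 mulr1 in bX; rewrite expr0 polyC1 mul1r in bY.
rewrite !mxE; do 3?[apply: bideg_leD; last apply/bideg_leN]; last first.
- exact: (bideg_leM bXY (bideg_le_const _)).
- exact: (bideg_leM bY (bideg_le_const _)).
- exact: (bideg_leM bX (bideg_le_const _)).
case: (i == j); first exact: (bideg_leW _ (bideg_le1 R)).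
by move=> m n _; rewrite mulr0n !coef0.
Qed.

(** Setting x = y = 0 is a ring morphism, so it commutes with the determinant, and it sends the
    pencil to the identity. *)
Lemma det_pencil00 (R : comNzRingType) (d : nat) (a b c : 'M[R]_d) :
  (\det (pencil a b c))`_0`_0 = 1.
Proof.
rewrite -!horner_coef0 -!horner_evalE -!det_map_mx.
rewrite -[RHS](det1 _ d); congr (\det _); apply/matrixP => i j.
rewrite !mxE !rmorphB !rmorphM !rmorph_nat /= /horner_eval !hornerE.
by rewrite !subr0.
Qed.

Lemma recursive_tiling_unique (R : pzRingType) (d : nat)
    (a b c : 'M[R]_d) (M M' : tiling 'M[R]_d) :
  recursive_tiling a b c M -> recursive_tiling a b c M' ->
  forall z, M z = M' z.
Proof.
move=> [M1 M0 MS] [M1' M0' MS'] [m n].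
have [k] := ubnP (`|m| + `|n|)%N; elim: k m n => // k IHk m n lek.
have [/andP[m_ge0 n_ge0] | neg] := boolP ((0 <= m) && (0 <= n)); last first.
  by rewrite M0 // M0'.
have [[-> ->] | nz] := eqVneq (m, n) (0, 0); first by rewrite M1 M1'.
have nz' : m != 0 \/ n != 0.
  by move: nz; rewrite xpair_eqE negb_and => /orP.
rewrite MS // MS' //.
(* A predecessor with a negative coordinate may escape the induction on |m| + |n|, but there both
   tilings vanish. *)
have IH (m' n' : int) : m' <= m -> n' <= n -> m' + n' < m + n ->
    M (m', n') = M' (m', n').
  move=> le_m le_n lt_mn.
  have [/andP[m'_ge0 n'_ge0] | neg] := boolP ((0 <= m') && (0 <= n')).
    by apply: IHk; lia.
  by rewrite M0 // M0'.
by rewrite !IH //; lia.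
Qed.

Lemma zcoef2_trunc1 (R : nzRingType) (q : nat) (u v : int)
    (f : {poly {poly R}}) :
  (forall m n, (m < q)%N -> (n < q)%N ->
     f`_n`_m = ((m == 0%N) && (n == 0%N))%:R) ->
  u < q%:Z -> v < q%:Z -> zcoef2 u v f = ((u == 0) && (v == 0))%:R.
Proof.
move=> f1; rewrite /zcoef2; case: v => n; last by rewrite raddf0 andbF.
by case: u => m //= ltm ltn; rewrite f1.
Qed.

(** Turns multiplication by a monomial term of [pencil] into the matching term of the recursion. *)
Lemma map_zcoef2_lift (R : nzRingType) (d k l : nat) (u v : int)
    (a : 'M[R]_d) (Z : 'M[{poly {poly R}}]_d) :
  map_mx (zcoef2 u v)
    (('X^k%:P * 'X^l) *: (map_mx (fun x : R => x%:P%:P) a *m Z)) =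
  a *m map_mx (zcoef2 (u - k%:Z) (v - l%:Z)) Z.
Proof.
apply/matrixP => i j; rewrite !mxE zcoef2XM /zcoef2 !raddf_sum /=.
apply: eq_bigr => m _; rewrite !mxE !mul_polyC !zcoefZ.
by rewrite mul_polyC zcoefZ.
Qed.

(* The coefficients of adj P / D. *)
Definition adj_tiling (p d : nat) (a b c : 'M['F_p]_d) : tiling 'M['F_p]_d :=
  fun z => \matrix_(i, j) \sum_(l < d) \sum_(k < d)
    ((\adj (pencil a b c)) i j)`_l`_k *
    recip_coef (\det (pencil a b c)) (z.1 - k%:Z) (z.2 - l%:Z).

(** Entries of the adjugate have degree at most [d.-1] in each variable, so the sums over ['I_d]
    give the whole product; one truncation [N] serves all shifted indices. *)
Lemma adj_tilingE (p d N : nat) (a b c : 'M['F_p]_d) (u v : int) :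
  prime p -> (0 < d)%N -> u < (p ^ N)%:Z -> v < (p ^ N)%:Z ->
  adj_tiling a b c (u, v) = map_mx (zcoef2 u v)
    (recip_trunc (\det (pencil a b c)) N *: \adj (pencil a b c)).
Proof.
move=> pr_p d_gt0 ltu ltv; apply/matrixP => i j.
rewrite [LHS]mxE [RHS]mxE [in RHS]mxE [in RHS]mulrC.
have := bideg_le_adj i j (bideg_le_pencil a b c).
rewrite muln1 => /zcoef2M ->; rewrite !prednK //=; apply: eq_bigr => l _.
apply: eq_bigr => k _; rewrite (@recip_coefE _ N) ?det_pencil00 ?mxE //; lia.
Qed.

(** Since P adj P = D, the product P Z is the scalar D^(p^N), which is 1 in degrees below p^N. That
    1 is the source term at the origin. *)
Lemma pencil_adj_recip (p d N : nat) (a b c : 'M['F_p]_d) (u v : int)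
    (Z := recip_trunc (\det (pencil a b c)) N *: \adj (pencil a b c)) :
  prime p -> u < (p ^ N)%:Z -> v < (p ^ N)%:Z ->
  map_mx (zcoef2 u v) Z =
    a *m map_mx (zcoef2 (u - 1) v) Z + b *m map_mx (zcoef2 u (v - 1)) Z
    + c *m map_mx (zcoef2 (u - 1) (v - 1)) Z
    + ((u == 0) && (v == 0))%:R%:M.
Proof.
move=> pr_p ltu ltv.
set D := \det (pencil a b c).
have PZ : pencil a b c *m Z = (D ^+ (p ^ N))%:M.
  rewrite /Z -scalemxAr mul_mx_adj -mul_scalar_mx -scalar_mxM -exprSr.
  by rewrite prednK // expn_gt0 prime_gt0.
have liftE k l (x : 'M_d) : map_mx (zcoef2 u v)
    (('X^k%:P * 'X^l) *: map_mx (fun x : 'F_p => x%:P%:P) x *m Z) =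
    x *m map_mx (zcoef2 (u - k%:Z) (v - l%:Z)) Z.
  by rewrite -scalemxAl map_zcoef2_lift.
have := liftE 1%N 0%N a; have := liftE 0%N 1%N b; have := liftE 1%N 1%N c.
rewrite !expr1 !expr0 polyC1 mul1r mulr1 !subr0 => <- <- <-.
have -> : ((u == 0) && (v == 0))%:R%:M =
    map_mx (zcoef2 u v) (D ^+ (p ^ N))%:M :> 'M_d.
  apply/matrixP => i j; rewrite !mxE; case: (i == j); last first.
    by rewrite /zcoef2 !mulr0n !raddf0.
  rewrite !mulr1n (@zcoef2_trunc1 _ (p ^ N)) // => m n ltm ltn.
  by apply: exp_pchar_trunc; rewrite ?pchar_Fp ?det_pencil00.
have addE A B : map_mx (zcoef2 u v) (A + B) =
    map_mx (zcoef2 u v) A + map_mx (zcoef2 u v) B :> 'M_d.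
  by apply/matrixP => i j; rewrite !mxE /zcoef2 !raddfD.
rewrite -!addE -PZ -!mulmxDl; congr (map_mx _ _).
(* What remains is 1 = A + B + C + (1 - A - B - C), with A, B, C the three terms of the pencil. *)
rewrite -[LHS]mul1mx; congr (_ *m _); rewrite /pencil.
have cancel (V : zmodType) (x A B C : V) : x = A + B + C + (x - A - B - C).
  by rewrite -2!(addrA x) -!opprD subrKC.
exact: cancel.
Qed.

Lemma adj_tiling_step (p d : nat) (a b c : 'M['F_p]_d) (u v : int) :
  prime p -> (0 < d)%N ->
  adj_tiling a b c (u, v) =
    a *m adj_tiling a b c (u - 1, v) + b *m adj_tiling a b c (u, v - 1)
    + c *m adj_tiling a b c (u - 1, v - 1) + ((u == 0) && (v == 0))%:R%:M.
Proof.
move=> pr_p d_gt0.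
have [N [ltu ltv]] := exists_exp_gt u v pr_p.
have ltu1 : u - 1 < (p ^ N)%:Z by lia.
have ltv1 : v - 1 < (p ^ N)%:Z by lia.
by rewrite !(@adj_tilingE p d N) // {1}pencil_adj_recip.
Qed.

Lemma adj_tiling_neg (p d : nat) (a b c : 'M['F_p]_d) (u v : int) :
  prime p -> (0 < d)%N -> ~~ ((0 <= u) && (0 <= v)) ->
  adj_tiling a b c (u, v) = 0.
Proof.
move=> pr_p d_gt0 neg.
have [N [ltu ltv]] := exists_exp_gt u v pr_p.
rewrite (@adj_tilingE p d N) //; apply/matrixP => i j; rewrite mxE [RHS]mxE.
rewrite /zcoef2; case: v neg {ltv} => [n|n]; case: u {ltu} => [m|m] //= _.
by rewrite coef0.
Qed.

Lemma recursive_tiling_adj (p d : nat) (a b c : 'M['F_p]_d) :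
  prime p -> (0 < d)%N -> recursive_tiling a b c (adj_tiling a b c).
Proof.
move=> pr_p d_gt0; split=> [|m n|m n _ _ nz].
(* All three predecessors of the origin lie outside the quadrant, so only the source term is
   left. *)
- by rewrite adj_tiling_step // !adj_tiling_neg // !mulmx0 !add0r.
- exact: adj_tiling_neg.
rewrite adj_tiling_step //; move: nz; rewrite xpair_eqE => /negPf ->.
by rewrite raddf0 addr0.
Qed.

(** * The substitution, the tiling and the linear map *)

Unset Implicit Arguments.

Theorem corollary1p6 (p d : nat) (hp : prime p) (hd : (1 <= d)%N)
    (a b c : 'M['F_p]_d) (M : tiling 'M['F_p]_d)
    (hM : recursive_tiling a b c M) :
  exists (S : substitution p 'M['F_p]_d) (T : tiling 'M['F_p]_d)
         (tau : 'M['F_p]_d -> 'M['F_p]_d),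
    [/\ linear S, invariant_under S T, linear tau
      & forall z : int * int, M z = tau (T z)].
Proof.
pose D := \det (pencil a b c).
have D1 : D`_0`_0 = 1 := det_pencil00 a b c.
(* The numerator of x^k y^l / D over the denominator D^p. *)
pose f (k l : nat) : {poly {poly 'F_p}} := 'X^k%:P * 'X^l * D ^+ p.-1.
(* A matrix serves as an array of d^2 coordinates: the row is the power of x, the column that of
   y. *)
exists (fun t => [ffun ij : 'I_p * 'I_p => \matrix_(k, l)
  \sum_(l' < d) \sum_(k' < d)
    (f k l)`_(p * l' + ij.2)`_(p * k' + ij.1) * t k' l']).
exists (fun z => \matrix_(k, l) recip_coef D (z.1 - k%:Z) (z.2 - l%:Z)).
(* Reassembles adj P / D from the coordinates x^k y^l / D. *)
exists (fun t => \matrix_(i, j) \sum_(l < d) \sum_(k < d)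
  ((\adj (pencil a b c)) i j)`_l`_k * t k l).
(* The entries of [S] and [tau] are double sums of this one shape. *)
have sum_linear (g : nat -> nat -> 'F_p) (x : 'F_p) (t t' : 'M['F_p]_d) :
    \sum_(l < d) \sum_(k < d) g l k * (x *: t + t') k l =
    x * (\sum_(l < d) \sum_(k < d) g l k * t k l) +
    \sum_(l < d) \sum_(k < d) g l k * t' k l.
  rewrite mulr_sumr -big_split; apply: eq_bigr => l _.
  rewrite mulr_sumr -big_split; apply: eq_bigr => k _.
  by rewrite !mxE mulrDr mulrCA.
split.
- move=> x t t'; apply/ffunP => ij; rewrite !ffunE; apply/matrixP => k l.
  rewrite [LHS]mxE (sum_linear (fun l' k' =>
    (f k l)`_(p * l' + ij.2)`_(p * k' + ij.1))).
  by rewrite !mxE.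
- move=> m n i j; rewrite ffunE; apply/matrixP => k l; rewrite !mxE /=.
  have [N [ltm ltn]] := exists_exp_gt m n hp.
  have lt_sub (u : int) (s : nat) : u < (p ^ N)%:Z -> u - s%:Z < (p ^ N)%:Z.
    by lia.
  (* From u <= p^N - 1 and r <= p - 1 follows p u + r < p^(N+1): the finer indices cost one more
     truncation step. *)
  have lt_dec (u : int) (r : 'I_p) (s : nat) : u < (p ^ N)%:Z ->
      p%:Z * u + r%:Z - s%:Z < (p ^ N.+1)%:Z.
    by rewrite expnS; have := ltn_ord r; nia.
  rewrite (@recip_coefE p N.+1) ?lt_dec //.
  (* The shift by (k, l) becomes a monomial factor, and splitting off D^(p-1) makes [f k l] appear
     before a [p]-th power. *)
  rewrite -zcoef2XM recip_truncS ?prime_gt0 // mulrA.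
  rewrite (@zcoef2_decimation p d) //; last first.
    (* The monomial has degree at most d - 1 and D^(p-1) at most (p - 1) d in each variable, in
       total d p - 1. *)
    have -> : (d * p).-1 = (d.-1 + p.-1 * (d * 1))%N.
      by have := prime_gt0 hp; nia.
    apply: bideg_leM; first by apply: bideg_le_monomial; rewrite -ltnS prednK.
    by apply/bideg_le_exp/bideg_le_det/bideg_le_pencil.
  apply: eq_bigr => l' _; apply: eq_bigr => k' _; rewrite mxE.
  by rewrite (@recip_coefE p N) // lt_sub.
- move=> x t t'; apply/matrixP => i j.
  rewrite [LHS]mxE (sum_linear (fun l k => ((\adj (pencil a b c)) i j)`_l`_k)).
  by rewrite !mxE.
move=> z.
rewrite (recursive_tiling_unique hM (recursive_tiling_adj a b c hp hd)).
apply/matrixP => i j; rewrite !mxE; apply: eq_bigr => l _.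
by apply: eq_bigr => k _; rewrite mxE.
Qed.
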